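(* Let $R$ be a finite commutative ring with $q>1$ elements, let $n$ be a positive integer, and let $f:R^n\longrightarrow R^n$ be a linear function. Then $f$ is a fixed point system if and only if $$f^{\lceil n\log_2(q)\rceil+1}=f^{\lceil n\log_2(q)\rceil}.$$ If $R$ has an identity element $1$ and $A$ is the $n\times n$ matrix of $f$ with respect to the canonical basis $e_1,\ldots,e_n$ of $R^n$, this condition is equivalent to $A^{\lceil n\log_2(q)\rceil+1}=A^{\lceil n\log_2(q)\rceil}$. If $R$ is a field, then $f$ is a fixed point system if and only if $f^{n+1}=f^{n}$, equivalently $A^{n+1}=A^{n}$.
   Context: Rings are not assumed to have an identity element unless stated. A linear function $R^n\to R^n$ is a homomorphism of $R$-modules. Elements of $R^n$ are viewed as column vectors. For a function $f:X\to X$ and a positive integer $m$, $f^m$ denotes the $m$-fold composition $f\circ\cdots\circ f$. A finite dynamical system is a function $f:X\to X$ on a finite set $X$. It is called a fixed point system if every cycle (periodic orbit) of $f$ has length one; that is, whenever $x\in X$ and $f^m(x)=x$ for some positive integer $m$, one has $f(x)=x$. *)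

(* Defs.v *)
From HB Require Import structures.
From mathcomp Require Import all_boot all_order all_algebra.
From mathcomp Require Import reals exp.

Set Implicit Arguments.
Unset Strict Implicit.
Unset Printing Implicit Defensive.

Import Order.TTheory GRing.Theory Num.Theory.

Local Open Scope ring_scope.

(* MathComp's ring hierarchy always has a unit, so commutative rings without
   a required identity element are added on top of zmodType. *)
HB.mixin Record Zmodule_isComNonUnitalRing R of GRing.Zmodule R := {
  numul : R -> R -> R;
  numulA : associative numul;
  numulC : commutative numul;
  numulDl : left_distributive numul +%R
}.

#[short(type="comNonUnitalRingType")]
HB.structure Definition ComNonUnitalRing :=
  {R of Zmodule_isComNonUnitalRing R & GRing.Zmodule R}.

#[short(type="finComNonUnitalRingType")]
HB.structure Definition FinComNonUnitalRing :=
  {R of ComNonUnitalRing R & Finite R}.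

Definition is_identity (R : comNonUnitalRingType) (u : R) : Prop :=
  left_id u numul.

(* R as a MathComp ring, given an identity element; this is what makes the
   library's matrix products and powers available over R. It is only a
   pzRingType since u = 0 is not excluded here. *)
Definition unital (R : comNonUnitalRingType) (u : R) (hu : is_identity u) :
  Type := R.

Section UnitalRing.
Variables (R : comNonUnitalRingType) (u : R) (hu : is_identity u).
HB.instance Definition _ := GRing.Zmodule.copy (unital hu) R.
HB.instance Definition _ := GRing.Zmodule_isComPzRing.Build (unital hu)
  (@numulA R) (@numulC R) hu (@numulDl R).
End UnitalRing.

Definition is_field (R : comNonUnitalRingType) (u : R)
  (hu : is_identity u) : Prop :=
  (1 : unital hu) != 0 /\
  forall x : unital hu, x != 0 -> exists y : unital hu, y * x = 1.

Definition nuscale (R : comNonUnitalRingType) (n : nat) (a : R)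
  (v : 'cV[R]_n) : 'cV[R]_n := \col_i numul a (v i 0).

(* Homomorphisms of R-modules R^n -> R^n; without an identity element,
   additivity and homogeneity cannot be merged into one condition. *)
Definition module_hom (R : comNonUnitalRingType) (n : nat)
  (f : 'cV[R]_n -> 'cV[R]_n) : Prop :=
  (forall v w, f (v + w) = f v + f w) /\
  (forall a v, f (nuscale a v) = nuscale a (f v)).

Definition canonical_basis (R : comNonUnitalRingType) (u : R) (n : nat)
  (j : 'I_n) : 'cV[R]_n := \col_i (if i == j then u else 0).

(* Vectors are columns: the j-th column of the matrix is f e_j. *)
Definition matrix_of (R : comNonUnitalRingType) (u : R) (hu : is_identity u)
  (n : nat) (f : 'cV[R]_n -> 'cV[R]_n) : 'M[unital hu]_n :=
  \matrix_(i, j) f (canonical_basis u j) i 0.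

Definition fixed_point_system (X : finType) (f : X -> X) : Prop :=
  forall (x : X) (m : nat), (0 < m)%N -> iter m f x = x -> f x = x.

Definition log2 (K : realType) (x : K) : K := ln x / ln 2.

(* Num.ceil is int-valued; for 0 < q the argument is nonnegative, so taking
   the absolute value only changes the type. *)
Definition ceil_nlog2 (K : realType) (n q : nat) : nat :=
  `|Num.ceil (n%:R * log2 (q%:R : K))|%N.

(* Main.v *)
(**
The images of the iterates of f form a descending chain of submodules of R^n,
and once two consecutive terms agree the chain is constant from there on. Each
strict step divides the cardinality by at least 2 (Lagrange), and by at least
q if R is a field, because the multiples of a vector outside the smaller
subspace lie in distinct cosets. Hence the chain is constant from the index
ceil(n log_2 q), respectively n, on. On the stable image f is onto, so all its
points are periodic, and f is a fixed point system exactly when it restricts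
to the identity there.
*)
Require Import Defs.
From mathcomp Require Import all_boot all_order all_algebra.
From mathcomp Require Import reals exp.

Set Implicit Arguments.
Unset Strict Implicit.
Unset Printing Implicit Defensive.

Import Order.TTheory GRing.Theory Num.Theory.
Local Open Scope ring_scope.

Lemma iter_add_eq (T : Type) (f : T -> T) (N k : nat) :
  iter N.+1 f =1 iter N f -> iter (k + N) f =1 iter N f.
Proof. by move=> fN x; elim: k => //= k ->; apply: fN. Qed.

(** A point of period m returns to itself after [N * m] steps. As [N * m] is at least N, those steps
    collapse to N, so the point lies in the image of [iter N f], which f fixes pointwise. *)
Lemma fixed_point_system_iter (T : finType) (f : T -> T) (N : nat) :
  iter N.+1 f =1 iter N f -> fixed_point_system f.
Proof.
move=> fN x m m0 fx.
have iterx k : iter (k * m) f x = x by elim: k => // k IH; rewrite mulSn iterD IH.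
have := iterx N; rewrite -(subnK (leq_pmulr N m0)) iter_add_eq // => {1}<-.
by rewrite -{2}(iterx N) -(subnK (leq_pmulr N m0)) iter_add_eq //; apply: fN.
Qed.

Definition iter_image (T : finType) (f : T -> T) (k : nat) : {set T} :=
  [set iter k f x | x : T].

Lemma iter_imageS (T : finType) (f : T -> T) (k : nat) :
  iter_image f k.+1 = f @: iter_image f k.
Proof. by rewrite /iter_image -imset_comp; apply: eq_imset => x. Qed.

Lemma iter_image_decr (T : finType) (f : T -> T) (k : nat) :
  iter_image f k.+1 \subset iter_image f k.
Proof.
by apply/subsetP => _ /imsetP[x _ ->]; rewrite iterSr; apply: imset_f.
Qed.

Lemma iter_image_add (T : finType) (f : T -> T) (N k : nat) :
  iter_image f N.+1 = iter_image f N -> iter_image f (k + N) = iter_image f N.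
Proof. by move=> fN; elim: k => // k IH; rewrite addSn iter_imageS IH -iter_imageS. Qed.

(** Here c is a lower bound for the factor lost at each strict step: 2 in general, the size of R
    over a field. The point x0 keeps every image nonempty. *)
Lemma iter_image_stable (T : finType) (f : T -> T) (c N : nat) (x0 : T) :
  (1 < c)%N -> (#|T| <= c ^ N)%N ->
  (forall k, iter_image f k.+1 \proper iter_image f k ->
     (c * #|iter_image f k.+1| <= #|iter_image f k|)%N) ->
  iter_image f N.+1 = iter_image f N.
Proof.
move=> c1 TN step.
(* Equality passes on to all later indices, so while it fails every step so far has been strict and
   the factors c accumulate. Failure at N would give [c ^ N.+1 <= c ^ N]. *)
have dich k : iter_image f k.+1 = iter_image f k \/
    (c ^ k.+1 * #|iter_image f k.+1| <= #|T|)%N.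
  elim: k => [|k IH].
    have [/step|] := boolP (iter_image f 1 \proper iter_image f 0).
      by move=> h; right; rewrite expn1 (leq_trans h) ?max_card.
    by rewrite properEneq iter_image_decr andbT negbK => /eqP; left.
  case: IH => [e|le]; first by left; rewrite iter_imageS e -iter_imageS.
  have [/step h|] := boolP (iter_image f k.+2 \proper iter_image f k.+1).
    by right; rewrite expnSr -mulnA (leq_trans _ le) // leq_mul2l h orbT.
  by rewrite properEneq iter_image_decr andbT negbK => /eqP; left.
case: (dich N) => // le.
have im0 : (0 < #|iter_image f N.+1|)%N.
  by apply/card_gt0P; exists (iter N.+1 f x0); apply: imset_f.
have := leq_trans (leq_trans (leq_pmulr _ im0) le) TN.
by rewrite leq_exp2l // ltnn.
Qed.

Lemma iter_eq_of_stable (T : finType) (f : T -> T) (N : nat) :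
  iter_image f N.+1 = iter_image f N -> fixed_point_system f ->
  iter N.+1 f =1 iter N f.
Proof.
move=> fN fp x /=.
have : iter N f x \in iter_image f (#|T| + N).
  by rewrite iter_image_add //; apply: imset_f.
case/imsetP => y _ ->.
(* By pigeonhole the orbit of y enters its cycle at some index a below [order f y], hence before
   index [#|T| + N]. The point reached there is thus periodic, with period [order f y - a]. *)
have /trajectP[a lt_a fa] := looping_order f y.
have le_a : (a <= #|T| + N)%N.
  exact: leq_trans (ltnW lt_a) (leq_trans (max_card _) (leq_addr _ _)).
apply: (fp _ (order f y - a)%N); first by rewrite subn_gt0.
rewrite -(subnK le_a) [in LHS]iterD -iterD addnC iterD -[iter _ f (iter a f y)]iterD.
by rewrite subnK ?(ltnW lt_a) // fa -iterD.
Qed.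

Lemma fixed_point_system_iff (T : finType) (f : T -> T) (c N : nat) (x0 : T) :
  (1 < c)%N -> (#|T| <= c ^ N)%N ->
  (forall k, iter_image f k.+1 \proper iter_image f k ->
     (c * #|iter_image f k.+1| <= #|iter_image f k|)%N) ->
  fixed_point_system f <-> iter N.+1 f =1 iter N f.
Proof.
move=> c1 TN step; split; last exact: fixed_point_system_iter.
by apply: iter_eq_of_stable; apply: iter_image_stable step.
Qed.

(** The [w i] represent distinct cosets of H in G, so [w i + h] determines both i and h. This covers
    the Lagrange bound and the field bound at once. *)
Lemma card_cosets_le (I : finType) (V : finZmodType) (G H : {set V})
    (w : I -> V) :
  (forall x y, x \in G -> y \in G -> x + y \in G) ->
  (forall x y, x \in H -> y \in H -> x - y \in H) ->
  H \subset G -> (forall i, w i \in G) ->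
  (forall i j, w i - w j \in H -> i = j) ->
  (#|I| * #|H| <= #|G|)%N.
Proof.
move=> GD HB /subsetP HG wG wI.
have <- : #|[set w p.1 + p.2 | p in setX [set: I] H]| = (#|I| * #|H|)%N.
  rewrite card_in_imset ?cardsX ?cardsT // => -[i h] [j k].
  rewrite !inE /= => hH kH e.
  have ij : i = j.
    apply: wI; suff -> : w i - w j = k - h by apply: HB.
    by apply/eqP; rewrite subr_eq addrAC eq_sym subr_eq addrC e.
  by move: e; rewrite ij => /addrI ->.
apply: subset_leq_card; apply/subsetP => _ /imsetP[[i h] /setXP[_ hH] ->].
by apply: GD => //; apply: HG.
Qed.

Lemma le_expn_ceil_nlog2 (K : realType) (n q : nat) :
  (0 < q)%N -> (q ^ n <= 2 ^ ceil_nlog2 K n q)%N.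
Proof.
move=> q0; have ln2 : 0 < ln 2 :> K by rewrite ln_gt0 // ltr1n.
rewrite -(ler_nat K) !natrX -ler_ln ?posrE ?exprn_gt0 ?ltr0n //.
(* After logarithms and division by [ln 2], it remains to bound n log2 q by its ceiling, itself at
   most its absolute value. *)
rewrite !lnXn ?ltr0n // -[leLHS]mulr_natl -[leRHS]mulr_natl -ler_pdivrMr //.
rewrite -mulrA; apply: le_trans (ceil_ge _) _.
by rewrite natr_absz ler_int; apply: ler_norm.
Qed.

Section ModuleHom.
Variables (R : finComNonUnitalRingType) (n : nat).
Variables (f : 'cV[R]_n -> 'cV[R]_n) (hf : module_hom f).

Lemma iter_module_hom (k : nat) : module_hom (iter k f).
Proof.
case: hf => fD fZ; split=> [v w|a v]; elim: k => //= k ->; [exact: fD|exact: fZ].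
Qed.

Lemma module_hom_sub v w : f (v - w) = f v - f w.
Proof. by apply/eqP; rewrite eq_sym subr_eq -hf.1 subrK. Qed.

End ModuleHom.

Section IterImage.
Variables (R : finComNonUnitalRingType) (n : nat).
Variables (f : 'cV[R]_n -> 'cV[R]_n) (hf : module_hom f).

Lemma iter_imageD (k : nat) v w : v \in iter_image f k ->
  w \in iter_image f k -> v + w \in iter_image f k.
Proof.
move=> /imsetP[x _ ->] /imsetP[y _ ->].
by rewrite -(iter_module_hom hf k).1; apply: imset_f.
Qed.

Lemma iter_imageB (k : nat) v w : v \in iter_image f k ->
  w \in iter_image f k -> v - w \in iter_image f k.
Proof.
move=> /imsetP[x _ ->] /imsetP[y _ ->].
by rewrite -(module_hom_sub (iter_module_hom hf k)); apply: imset_f.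
Qed.

Lemma iter_imageZ (k : nat) a v : v \in iter_image f k ->
  nuscale a v \in iter_image f k.
Proof.
by move=> /imsetP[x _ ->]; rewrite -(iter_module_hom hf k).2; apply: imset_f.
Qed.

Lemma iter_image_step (k : nat) : iter_image f k.+1 \proper iter_image f k ->
  (2 * #|iter_image f k.+1| <= #|iter_image f k|)%N.
Proof.
case/properP => sub [v vG vH]; rewrite -card_bool.
(* Two cosets suffice: those of 0 and of a vector v outside the smaller image. *)
apply: (@card_cosets_le _ _ _ _ (fun b : bool => if b then v else 0)) => //.
- exact: iter_imageD.
- exact: iter_imageB.
- by case=> //; rewrite -(subrr v); apply: iter_imageB.
- case=> -[] //; first by rewrite subr0 (negPf vH).
  move=> vN; case/negP: vH; rewrite -[v]subr0 -opprB.
  by rewrite -sub0r; apply: (iter_imageB _ vN); rewrite -(subrr (0 - v)) iter_imageB.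
Qed.

(** If two multiples a v and b v with a different from b were congruent modulo the smaller image,
    scaling their difference by the inverse of a - b would put v in that image. *)
Lemma iter_image_field_step (u : R) (hu : is_identity u) (k : nat) :
  is_field hu -> iter_image f k.+1 \proper iter_image f k ->
  (#|R| * #|iter_image f k.+1| <= #|iter_image f k|)%N.
Proof.
case=> _ inv /properP[sub [v vG vH]].
apply: (@card_cosets_le _ _ _ _ (fun a => nuscale a v)) => //.
- exact: iter_imageD.
- exact: iter_imageB.
- by move=> a; apply: iter_imageZ.
- move=> a b ab; apply/eqP; rewrite -subr_eq0; apply/negPn/negP => ab0.
  have [y y1] := inv _ ab0.
  case/negP: vH; suff -> : v = nuscale y (nuscale a v - nuscale b v).
    exact: iter_imageZ.
  apply/matrixP => i j; rewrite !mxE (ord1 j).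
  have -> : numul a (v i 0) - numul b (v i 0) = numul (a - b) (v i 0).
    exact: (esym (@mulrBl (unital hu) _ _ _)).
  rewrite numulA (_ : numul y (a - b) = u) ?hu //.
Qed.

Lemma module_hom_matrix (u : R) (hu : is_identity u) (v : 'cV[unital hu]_n) :
  f v = matrix_of hu f *m v.
Proof.
have f0 : f 0 = 0 by apply: (addrI (f 0)); rewrite -hf.1 !addr0.
(* The identity element enters here: each coordinate is recovered as a multiple of u. *)
have vE : v = \sum_j nuscale (v j 0) (canonical_basis u j) :> 'cV[R]_n.
  apply/matrixP => i j; rewrite (ord1 j) summxE (bigD1 i) //= !mxE eqxx big1.
    by rewrite addr0 numulC hu.
  move=> k ki; rewrite !mxE eq_sym (negPf ki).
  exact: (@mulr0 (unital hu)).
rewrite {1}vE (big_morph f hf.1 f0).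
apply/matrixP => i j; rewrite (ord1 j) summxE mxE; apply: eq_bigr => k _.
by rewrite hf.2 !mxE numulC.
Qed.

Lemma iter_module_hom_matrix (u : R) (hu : is_identity u) (k : nat)
    (v : 'cV[unital hu]_n) :
  iter k f v = matrix_of hu f ^+ k *m v.
Proof.
elim: k => [|k IH]; first by rewrite expr0 mul1mx.
by rewrite iterS IH module_hom_matrix exprS mulmxA.
Qed.

Lemma iter_eq_matrix (u : R) (hu : is_identity u) (N : nat) :
  (iter N.+1 f =1 iter N f) <->
  (matrix_of hu f ^+ N.+1 = matrix_of hu f ^+ N).
Proof.
split=> [fN|AN v]; last first.
  by rewrite !(iter_module_hom_matrix _ (v : 'cV[unital hu]_n)) AN.
(* Evaluation at the j-th unit vector extracts the j-th column of each power. *)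
apply/matrixP => i j; have := fN (delta_mx j 0 : 'cV[unital hu]_n).
rewrite !iter_module_hom_matrix -!colE => /matrixP/(_ i 0).
by rewrite !mxE.
Qed.

End IterImage.

Theorem theorem2p2 (K : realType) (R : finComNonUnitalRingType)
    (hq : (1 < #|R|)%N) (n : nat) (hn : (0 < n)%N)
    (f : 'cV[R]_n -> 'cV[R]_n) (hf : module_hom f) :
  let N := ceil_nlog2 K n #|R| in
  [/\ (fixed_point_system f <-> iter N.+1 f =1 iter N f),
      (forall (u : R) (hu : is_identity u),
         let A := matrix_of hu f in
         (iter N.+1 f =1 iter N f) <-> (A ^+ N.+1 = A ^+ N))
    & (forall (u : R) (hu : is_identity u), is_field hu ->
         let A := matrix_of hu f in
         (fixed_point_system f <-> iter n.+1 f =1 iter n f) /\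
         ((iter n.+1 f =1 iter n f) <-> (A ^+ n.+1 = A ^+ n)))].
Proof.
move=> N; split=> [|u hu A|u hu hR A]; [|exact: iter_eq_matrix|split; last exact: iter_eq_matrix].
- apply: (@fixed_point_system_iff _ f 2 N 0) => //.
    by rewrite card_mx muln1; apply: le_expn_ceil_nlog2; apply: ltnW.
  exact: iter_image_step.
(* With c the size q of R, the cardinality of R^n is exactly c^n, so n steps suffice and no
   logarithm appears. *)
- apply: (@fixed_point_system_iff _ f #|R| n 0) => //.
    by rewrite card_mx muln1.
  by move=> k; apply: iter_image_field_step hR.
Qed.
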